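(* Let $A=K[x_1,x_2,x_3;Q,\mathbb{A},\mathbb{B}]$ be a bi-quadratic algebra on 3 generators over a field $K$. Suppose that all $q_i\ne 1$, $q_1-q_3\ne 0$, $1-q_1q_2\ne 0$ and $1-q_2q_3\ne 0$. Then (up to $G_3$) $\mathbb{A}=0$ and $\mathbb{B}=0$, i.e., $A\simeq\mathbb{A}^3_Q$.
   Context: Let $K$ be a field, $K^\times=K\setminus\{0\}$. A bi-quadratic algebra on 3 generators $A=K[x_1,x_2,x_3;Q,\mathbb{A},\mathbb{B}]$ is the $K$-algebra generated by $x_1,x_2,x_3$ subject to the defining relations $x_2x_1-q_1x_1x_2=ax_1+bx_2+cx_3+b_1$, $x_3x_1-q_2x_1x_3=\alpha x_1+\beta x_2+\gamma x_3+b_2$, $x_3x_2-q_3x_2x_3=\lambda x_1+\mu x_2+\nu x_3+b_3$, where $Q=(q_1,q_2,q_3)\in (K^\times)^3$, $\mathbb{A}=\begin{pmatrix}a&b&c\\ \alpha&\beta&\gamma\\ \lambda&\mu&\nu\end{pmatrix}$ has entries in $K$, $\mathbb{B}=(b_1,b_2,b_3)\in K^3$; it is always assumed that the monomials $x_1^ix_2^jx_3^k$ ($i,j,k\ge0$) form a $K$-basis of $A$ (PBW basis). The quantum space $\mathbb{A}^3_Q$ is the algebra of this form with $\mathbb{A}=0$ and $\mathbb{B}=0$. $G_3$ is the group of affine changes of generators $x_i\mapsto\lambda_ix_i+\mu_i$ ($\lambda_i\in K^\times$, $\mu_i\in K$, $i=1,2,3$). ''Up to $G_3$'' means: after such a change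 of the canonical generators, with $\mathbb{A}$ and $\mathbb{B}$ computed for the new canonical generators. *)

(* Defs.v *)
From HB Require Import structures.
From mathcomp Require Import all_boot all_order all_algebra.
From mathcomp Require Import boolp.
From mathcomp Require Import monalg.

Set Implicit Arguments.
Unset Strict Implicit.
Unset Printing Implicit Defensive.

Import GRing.Theory.
Local Open Scope ring_scope.
Local Open Scope quotient_scope.

(* monalg provides an [algType] structure for commutative monoids only, hence
   the alias; its operations are those of monalg, locked so that unification
   does not unfold them. *)
Definition free_alg (K : fieldType) (n : nat) := {malg K[{fmonom 'I_n}]}.

HB.instance Definition _ (K : fieldType) (n : nat) :=
  GRing.Zmodule.copy (free_alg K n) {malg K[{fmonom 'I_n}]}.

HB.lock Definition free_one (K : fieldType) (n : nat) : free_alg K n :=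
  (1 : {malg K[{fmonom 'I_n}]}).
HB.lock Definition free_mul (K : fieldType) (n : nat) (u v : free_alg K n) :
  free_alg K n := (u : {malg K[{fmonom 'I_n}]}) * (v : {malg K[{fmonom 'I_n}]}).
HB.lock Definition free_scale (K : fieldType) (n : nat) (c : K)
  (u : free_alg K n) : free_alg K n := c *: (u : {malg K[{fmonom 'I_n}]}).

Section FreeAlg.
Variables (K : fieldType) (n : nat).
Local Notation F := (free_alg K n).
Local Notation M := {malg K[{fmonom 'I_n}]}.
Local Notation mul := (@free_mul K n).
Local Notation one := (@free_one K n).
Local Notation scale := (@free_scale K n).

Fact free_mulA : associative mul.
Proof. by move=> u v w; rewrite !free_mul.unlock; apply: (@mulrA M). Qed.

Fact free_mul1 : left_id one mul.
Proof. by move=> u; rewrite free_mul.unlock free_one.unlock; apply: (@mul1r M). Qed.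

Fact free_mulr1 : right_id one mul.
Proof. by move=> u; rewrite free_mul.unlock free_one.unlock; apply: (@mulr1 M). Qed.

Fact free_mulDl : left_distributive mul +%R.
Proof. by move=> u v w; rewrite free_mul.unlock; apply: (@mulrDl M). Qed.

Fact free_mulDr : right_distributive mul +%R.
Proof. by move=> u v w; rewrite free_mul.unlock; apply: (@mulrDr M). Qed.

Fact free_one_neq0 : one != 0.
Proof. by rewrite free_one.unlock; apply: (@oner_neq0 M). Qed.

HB.instance Definition _ := GRing.Zmodule_isNzRing.Build F
  free_mulA free_mul1 free_mulr1 free_mulDl free_mulDr free_one_neq0.

Fact free_scaleA a b u : scale a (scale b u) = scale (a * b) u.
Proof. by rewrite free_scale.unlock; apply: (@scalerA K M). Qed.

Fact free_scale1 : left_id 1 scale.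
Proof. by move=> u; rewrite free_scale.unlock; apply: (@scale1r K M). Qed.

Fact free_scaleDr : right_distributive scale +%R.
Proof. by move=> c u v; rewrite free_scale.unlock; apply: (@scalerDr K M). Qed.

Fact free_scaleDl u : {morph scale^~ u : a b / a + b}.
Proof. by move=> a b; rewrite free_scale.unlock; apply: (@scalerDl K M). Qed.

HB.instance Definition _ := GRing.Zmodule_isLmodule.Build K F
  free_scaleA free_scale1 free_scaleDr free_scaleDl.

Lemma free_oneE : 1 = (1 : M) :> F.
Proof. by rewrite -[LHS]/one free_one.unlock. Qed.

Lemma free_mulE (u v : F) : u * v = (u : M) * (v : M) :> F.
Proof. by rewrite -[LHS]/(mul u v) free_mul.unlock. Qed.

Lemma free_scaleE c (u : F) : c *: u = c *: (u : M) :> F.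
Proof. by rewrite -[LHS]/(scale c u) free_scale.unlock. Qed.

Fact free_scalerAl (c : K) (u v : F) : c *: (u * v) = (c *: u) * v.
Proof. by rewrite !free_scaleE !free_mulE; apply: (@scalerAl K M). Qed.

Fact free_scalerAr (c : K) (u v : F) : c *: (u * v) = u * (c *: v).
Proof.
rewrite !free_scaleE !free_mulE.
have malgCC (w : M) : c%:MP * w = w * c%:MP.
  rewrite !malgM_def fgmulUg fgmulgU.
  by apply/eq_bigr=> k _; rewrite mul1m mulm1 mulrC.
have: c%:MP * ((u : M) * (v : M)) = (u : M) * (c%:MP * (v : M)).
  by rewrite mulrA malgCC -mulrA.
by rewrite !mul_malgC.
Qed.

HB.instance Definition _ := GRing.Lmodule_isLalgebra.Build K F free_scalerAl.
HB.instance Definition _ := GRing.Lalgebra_isAlgebra.Build K F free_scalerAr.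

Definition free_gen (i : 'I_n) : F := << fmu i >>.

End FreeAlg.

Inductive in_ideal (R : pzRingType) (S : R -> Prop) : R -> Prop :=
| in_ideal_gen x of S x : in_ideal S x
| in_ideal0 : in_ideal S 0
| in_idealB x y of in_ideal S x & in_ideal S y : in_ideal S (x - y)
| in_idealM a x b of in_ideal S x : in_ideal S (a * x * b).

Definition two_sided (R : pzRingType) (S : R -> Prop) : R -> bool :=
  fun x => `[< in_ideal S x >].

Section TwoSided.
Variables (R : pzRingType) (S : R -> Prop).

Fact two_sided_zmod_closed : zmod_closed (two_sided S).
Proof.
split=> [|x y /asboolP Sx /asboolP Sy]; apply/asboolP; first exact: in_ideal0.
exact: in_idealB.
Qed.

HB.instance Definition _ :=
  GRing.isZmodClosed.Build R (two_sided S) two_sided_zmod_closed.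

Definition two_sided_ideal : zmodClosed R :=
  GRing.ZmodClosed.clone R (two_sided S) _.

End TwoSided.

(* F / (S): since it may be the zero ring, it is only given the structures of a
   [pzRingType] and of a [lmodType K] ([algType K] requires 1 != 0), together
   with the algebra laws [quot_algAl] and [quot_algAr]. *)
Definition quot_alg (K : fieldType) (F : algType K) (S : F -> Prop) :=
  Quotient.quot (two_sided_ideal S).

HB.instance Definition _ (K : fieldType) (F : algType K) (S : F -> Prop) :=
  GRing.Zmodule.on (quot_alg S).

HB.lock Definition quot_pi (K : fieldType) (F : algType K) (S : F -> Prop)
  (x : F) : quot_alg S := \pi_(Quotient.quot (two_sided_ideal S)) x.

HB.lock Definition quot_rep (K : fieldType) (F : algType K) (S : F -> Prop)
  (u : quot_alg S) : F := repr (u : Quotient.quot (two_sided_ideal S)).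

Section QuotAlg.
Variables (K : fieldType) (F : algType K) (S : F -> Prop).
Local Notation Q := (quot_alg S).
Local Notation I := (two_sided_ideal S).
Local Notation quot_pi := (@quot_pi K F S).

Lemma quot_repK u : quot_pi (quot_rep u) = u.
Proof. by rewrite quot_pi.unlock quot_rep.unlock reprK. Qed.

Lemma quot_pi_surj (u : Q) : exists x, quot_pi x = u.
Proof. by exists (quot_rep u); rewrite quot_repK. Qed.

Lemma quot_piP (x y : F) : quot_pi x = quot_pi y <-> in_ideal S (x - y).
Proof.
rewrite quot_pi.unlock; split=> [/eqP|Sxy].
  by rewrite -Quotient.idealrBE => /asboolP.
by apply/eqP; rewrite -Quotient.idealrBE; apply/asboolP.
Qed.

Let quot_rep_pi x : in_ideal S (x - quot_rep (quot_pi x)).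
Proof. by apply/quot_piP; rewrite quot_repK. Qed.

Fact quot_pi_is_zmod_morphism : zmod_morphism quot_pi.
Proof.
by move=> x y; rewrite quot_pi.unlock; apply: (raddfB \pi_(Quotient.quot I)).
Qed.

HB.instance Definition _ :=
  GRing.isZmodMorphism.Build F Q quot_pi quot_pi_is_zmod_morphism.

Definition quot_one : Q := quot_pi 1.
Definition quot_mul (u v : Q) : Q := quot_pi (quot_rep u * quot_rep v).
Definition quot_scale (c : K) (u : Q) : Q := quot_pi (c *: quot_rep u).

Fact quot_mulE x y : quot_mul (quot_pi x) (quot_pi y) = quot_pi (x * y).
Proof.
apply/esym/quot_piP.
set x' := quot_rep _; set y' := quot_rep _.
have -> : x * y - x' * y' = 1 * (x - x') * y - (- x') * (y - y') * 1.
  by rewrite mul1r mulr1 mulNr opprK mulrBl mulrBr addrA subrK.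
by apply: in_idealB; apply: in_idealM; apply: quot_rep_pi.
Qed.

Fact quot_scaleE c x : quot_scale c (quot_pi x) = quot_pi (c *: x).
Proof.
apply/esym/quot_piP; rewrite -scalerBr -[_ - _]mul1r scalerAl -[_ * _]mulr1.
exact/in_idealM/quot_rep_pi.
Qed.

Fact quot_mulA : associative quot_mul.
Proof.
move=> u v w; rewrite -[u]quot_repK -[v]quot_repK -[w]quot_repK.
by rewrite !quot_mulE mulrA.
Qed.

Fact quot_mul1 : left_id quot_one quot_mul.
Proof. by move=> u; rewrite -[u]quot_repK quot_mulE mul1r. Qed.

Fact quot_mulr1 : right_id quot_one quot_mul.
Proof. by move=> u; rewrite -[u]quot_repK quot_mulE mulr1. Qed.

Fact quot_mulDl : left_distributive quot_mul +%R.
Proof.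
move=> u v w; rewrite -[u]quot_repK -[v]quot_repK -[w]quot_repK.
by rewrite -raddfD !quot_mulE -raddfD mulrDl.
Qed.

Fact quot_mulDr : right_distributive quot_mul +%R.
Proof.
move=> u v w; rewrite -[u]quot_repK -[v]quot_repK -[w]quot_repK.
by rewrite -raddfD !quot_mulE -raddfD mulrDr.
Qed.

HB.instance Definition _ := GRing.Zmodule_isPzRing.Build Q
  quot_mulA quot_mul1 quot_mulr1 quot_mulDl quot_mulDr.

Fact quot_pi_is_monoid_morphism : monoid_morphism quot_pi.
Proof. by split=> // x y; rewrite [RHS]quot_mulE. Qed.

HB.instance Definition _ :=
  GRing.isMonoidMorphism.Build F Q quot_pi quot_pi_is_monoid_morphism.

Fact quot_scaleA a b u : quot_scale a (quot_scale b u) = quot_scale (a * b) u.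
Proof. by rewrite -[u]quot_repK !quot_scaleE scalerA. Qed.

Fact quot_scale1 : left_id 1 quot_scale.
Proof. by move=> u; rewrite -[u]quot_repK quot_scaleE scale1r. Qed.

Fact quot_scaleDr : right_distributive quot_scale +%R.
Proof.
move=> c u v; rewrite -[u]quot_repK -[v]quot_repK.
by rewrite -raddfD !quot_scaleE -raddfD scalerDr.
Qed.

Fact quot_scaleDl u : {morph quot_scale^~ u : a b / a + b}.
Proof.
move=> a b; rewrite -[u]quot_repK !quot_scaleE -raddfD.
by rewrite scalerDl.
Qed.

HB.instance Definition _ := GRing.Zmodule_isLmodule.Build K Q
  quot_scaleA quot_scale1 quot_scaleDr quot_scaleDl.

Fact quot_pi_is_scalable : scalable quot_pi.
Proof. by move=> c x; rewrite [RHS]quot_scaleE. Qed.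

HB.instance Definition _ :=
  GRing.isScalable.Build K F Q *:%R quot_pi quot_pi_is_scalable.

Lemma quot_piZ c x : quot_pi (c *: x) = c *: quot_pi x.
Proof. exact: quot_pi_is_scalable. Qed.

Lemma quot_algAl (c : K) (u v : Q) : c *: (u * v) = (c *: u) * v.
Proof.
have [x <-] := quot_pi_surj u; have [y <-] := quot_pi_surj v.
by rewrite -rmorphM -!quot_piZ -rmorphM scalerAl.
Qed.

Lemma quot_algAr (c : K) (u v : Q) : c *: (u * v) = u * (c *: v).
Proof.
have [x <-] := quot_pi_surj u; have [y <-] := quot_pi_surj v.
by rewrite -rmorphM -!quot_piZ -rmorphM scalerAr.
Qed.

End QuotAlg.

Definition is_basis (K : fieldType) (V : lmodType K) (I : eqType) (b : I -> V) :=
  (forall v, exists (s : seq I) (c : I -> K), v = \sum_(i <- s) c i *: b i) /\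
  (forall (s : seq I) (c : I -> K), uniq s ->
     \sum_(i <- s) c i *: b i = 0 -> {in s, forall i, c i = 0}).

Section BiQuadratic.
Variables (K : fieldType) (Q : 'rV[K]_3) (AA : 'M[K]_3) (BB : 'rV[K]_3).

(* Indices are shifted by one: x_1, x_2, x_3 are the generators 0, 1, 2, and
   the k-th relation involves the pairs (x_1, x_2), (x_1, x_3), (x_2, x_3) for
   k = 0, 1, 2, i.e. q_1, q_2, q_3 and the rows of AA in this order. *)
Definition bq_pair (k : 'I_3) : 'I_3 * 'I_3 :=
  nth (0, 0) [:: (0, 1); (0, 2); (1, 2)] k.

Definition bq_relator (k : 'I_3) : free_alg K 3 :=
  let x := @free_gen K 3 in
  let: (i, j) := bq_pair k in
  x j * x i - Q 0 k *: (x i * x j)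
    - (\sum_(l < 3) AA k l *: x l + (BB 0 k)%:A).

Definition bq_alg := quot_alg (fun r => exists k, r = bq_relator k).

HB.instance Definition _ := GRing.PzRing.on bq_alg.
HB.instance Definition _ := GRing.Lmodule.on bq_alg.

Definition bq_gen (i : 'I_3) : bq_alg := quot_pi _ (free_gen K i).

Definition bq_monomial (e : nat * nat * nat) : bq_alg :=
  bq_gen 0 ^+ e.1.1 * bq_gen 1 ^+ e.1.2 * bq_gen 2 ^+ e.2.

Definition bi_quadratic :=
  (forall i, Q 0 i != 0) /\ is_basis bq_monomial.

End BiQuadratic.

Definition quantum_space (K : fieldType) (Q : 'rV[K]_3) := bq_alg Q 0 0.

Definition alg_iso (K : fieldType) (Q Q' : 'rV[K]_3) (AA AA' : 'M[K]_3)
    (BB BB' : 'rV[K]_3) (phi : bq_alg Q AA BB -> bq_alg Q' AA' BB') :=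
  [/\ linear phi, monoid_morphism phi & bijective phi].

(* The elements l_i x_i + m_i (l_i != 0) of K[x; Q, AA, BB] are the canonical
   generators of a presentation with data (Q, AA', BB'). *)
Definition G3_equiv (K : fieldType) (Q : 'rV[K]_3)
    (AA : 'M[K]_3) (BB : 'rV[K]_3) (AA' : 'M[K]_3) (BB' : 'rV[K]_3) :=
  exists (l m : 'rV[K]_3) (phi : bq_alg Q AA' BB' -> bq_alg Q AA BB),
    [/\ forall i, l 0 i != 0, alg_iso phi &
        forall i, phi (bq_gen Q AA' BB' i)
                  = l 0 i *: bq_gen Q AA BB i + m 0 i *: (1 : bq_alg Q AA BB)].

(* Main.v *)
Require Import Defs.
From HB Require Import structures.
From mathcomp Require Import all_boot all_order all_algebra.
From mathcomp Require Import boolp functions.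
From mathcomp Require Import finmap monalg ring.

(* Comparing the two reductions x_3 (x_2 x_1) = (x_3 x_2) x_1 in the PBW basis
   gives lambda = beta = c = 0 in degree two, and forces the remaining entries
   of AA to be (1 - q_k) times three scalars m_1, m_2, m_3; the degree-one
   coefficients then give b_k = - (1 - q_k) m_i m_j. These are precisely the
   data obtained from the quantum space by translating x_i to x_i + m_i, so the
   two algebras are isomorphic. The PBW basis of the quantum space itself is
   obtained from its action on coordinate functions nat^3 -> K. *)

Set Implicit Arguments.
Unset Strict Implicit.
Unset Printing Implicit Defensive.

Import GRing.Theory.
Local Open Scope ring_scope.

(** * Modules over the free algebra, given by a family of linear operators *)

Section FreeAction.
Variables (K : fieldType) (n : nat).
Local Notation F := (free_alg K n).
Local Notation M := {malg K[{fmonom 'I_n}]}.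
Local Notation x := (@free_gen K n).

Lemma free_gen_monom (i : 'I_n) (k : {fmonom 'I_n}) :
  x i * (<< k >> : M) = << fmmul (fmu i) k >> :> F.
Proof. by rewrite free_mulE malgM_def /free_gen fgmulUU mulr1. Qed.

(** Every element is a finite sum of scaled words, and every word arises from the empty one by left
    multiplication by generators. *)
Lemma free_ind (P : F -> Prop) :
    P 1 -> (forall u v, P u -> P v -> P (u + v)) ->
    (forall c u, P u -> P (c *: u)) -> (forall i u, P u -> P (x i * u)) ->
  forall u, P u.
Proof.
move=> P1 PD PZ PX.
have P0 : P 0 by rewrite -(scale0r 1); apply: PZ.
have Pm (k : {fmonom 'I_n}) : P (<< k >> : M).
  case: k => s; elim: s => [|i s IHs].
    suff <- : (1 : F) = << FMonom [::] >> by [].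
    by rewrite free_oneE -fmoneE.
  suff <- : x i * (<< FMonom s >> : M) = << FMonom (i :: s) >> :> F.
    exact: PX.
  by rewrite free_gen_monom fmmulE fmuE.
move=> u; rewrite [u](monalgE (u : M)).
elim/big_ind: _ => [|v w|k _]; [exact: P0 | exact: PD |].
suff <- : mcoeff k u *: (<< k >> : F) = << (mcoeff k u) *g k >> :> F.
  exact/PZ/Pm.
rewrite free_scaleE; apply/malgP => k'.
by rewrite mcoeffZ !mcoeffU mulrnAr mulr1.
Qed.

Variables (V : lmodType K) (X : 'I_n -> V -> V).
Hypothesis X_linear : forall i, linear (X i).

HB.instance Definition _ i :=
  GRing.isLinear.Build K V V *:%R (X i) (X_linear i).

(** The leftmost letter acts last, so that concatenation of words becomes composition of operators,
    as in a left module. *)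
Definition word_act (k : {fmonom 'I_n}) (v : V) : V := foldr X v k.

Definition free_act (u : F) (v : V) : V :=
  \sum_(k <- msupp (u : M)) (u : M)@_k *: word_act k v.

(** Words outside the support contribute zero. Summing over a larger set lets elements with
    different supports share one index set. *)
Lemma free_actEw (d : {fset {fmonom 'I_n}}) (u : F) v :
  fsubset (msupp (u : M)) d ->
  free_act u v = \sum_(k <- d) (u : M)@_k *: word_act k v.
Proof.
move=> le; rewrite /free_act (big_fset_incl _ le) => //= k xd /mcoeff_outdom ->.
by rewrite scale0r.
Qed.

Lemma free_act_monom c k v : free_act (<< c *g k >> : M) v = c *: word_act k v.
Proof. by rewrite (free_actEw _ msuppU_le) big_seq_fset1 mcoeffUU. Qed.

Lemma free_act_linearl v : linear (free_act^~ v).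
Proof.
move=> c u w.
have le1 : fsubset (msupp (u : M)) (fsetU (msupp (u : M)) (msupp (w : M))).
  exact: fsubsetUl.
have le2 : fsubset (msupp (w : M)) (fsetU (msupp (u : M)) (msupp (w : M))).
  exact: fsubsetUr.
have le3 : fsubset (msupp ((c *: u + w : F) : M))
                   (fsetU (msupp (u : M)) (msupp (w : M))).
  apply: fsubset_trans (msuppD_le _ _) _; apply: fsetSU.
  by rewrite free_scaleE; apply: msuppZ_le.
rewrite (free_actEw _ le1) (free_actEw _ le2) (free_actEw _ le3) scaler_sumr.
rewrite -big_split; apply: eq_bigr => k _ /=.
suff -> : mcoeff k (c *: u + w : F) = c * mcoeff k (u : M) + mcoeff k (w : M).
  by rewrite scalerDl scalerA.
by rewrite [LHS]mcoeffD free_scaleE mcoeffZ.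
Qed.

Lemma free_actZl c u v : free_act (c *: u) v = c *: free_act u v.
Proof.
have := free_act_linearl v c u 0; rewrite addr0 => ->.
by rewrite /free_act msupp0 big_seq_fset0 addr0.
Qed.

Lemma free_actDl u w v : free_act (u + w) v = free_act u v + free_act w v.
Proof. by have := free_act_linearl v 1 u w; rewrite !scale1r. Qed.

Lemma word_act_linear k : linear (word_act k).
Proof.
case: k => s; rewrite /word_act /=; elim: s => [|i s IHs] c u v //=.
by rewrite IHs linearP.
Qed.

Lemma free_act_linearr u : linear (free_act u).
Proof.
move=> c v w; rewrite /free_act scaler_sumr -big_split; apply: eq_bigr => k _.
by rewrite word_act_linear scalerDr !scalerA mulrC.
Qed.

Lemma free_act1 v : free_act 1 v = v.
Proof. by rewrite free_oneE [LHS]free_act_monom scale1r /word_act fm1. Qed.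

Lemma free_act_gen i v : free_act (x i) v = X i v.
Proof. by rewrite [LHS]free_act_monom scale1r /word_act fmU. Qed.

Lemma free_act_genM i u v : free_act (x i * u) v = X i (free_act u v).
Proof.
rewrite free_mulE malgM_def /free_gen fgmulUg.
have act0 : free_act 0 v = 0 by rewrite /free_act msupp0 big_seq_fset0.
rewrite [LHS](big_morph (free_act^~ v) (fun u w => free_actDl u w v) act0).
rewrite [in RHS]/free_act linear_sum; apply: eq_bigr => k _ /=.
by rewrite [LHS]free_act_monom mul1r linearZ /word_act fmM fmU.
Qed.

(** Induction on the left factor leaves only the case of a generator, which is [free_act_genM]. *)
Lemma free_actM u w v : free_act (u * w) v = free_act u (free_act w v).
Proof.
elim/free_ind: u => [|u u' IH IH'|c u IH|i u IH].
- by rewrite mul1r free_act1.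
- by rewrite mulrDl !free_actDl IH IH'.
- by rewrite -scalerAl !free_actZl IH.
- by rewrite -mulrA !free_act_genM IH.
Qed.

End FreeAction.

(** * Relations, induction and modules for an algebra given by generators and relations *)

Section BqPresentation.
Variables (K : fieldType) (Q : 'rV[K]_3) (AA : 'M[K]_3) (BB : 'rV[K]_3).
Local Notation A := (bq_alg Q AA BB).
Local Notation x := (bq_gen Q AA BB).

Lemma bq_algAl (c : K) (u v : A) : c *: (u * v) = (c *: u) * v.
Proof. exact: quot_algAl. Qed.

Lemma bq_algAr (c : K) (u v : A) : c *: (u * v) = u * (c *: v).
Proof. exact: quot_algAr. Qed.

Lemma bq_qcommX (u v : A) (q : K) n :
  v * u = q *: (u * v) -> v * u ^+ n = q ^+ n *: (u ^+ n * v).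
Proof.
move=> uv; elim: n => [|n IH]; first by rewrite !expr0 scale1r mulr1 mul1r.
rewrite exprS mulrA uv -bq_algAl -mulrA IH -bq_algAr scalerA mulrA.
by rewrite -!exprS.
Qed.

Lemma bq_ind (P : A -> Prop) :
    P 1 -> (forall u v, P u -> P v -> P (u + v)) ->
    (forall c u, P u -> P (c *: u)) -> (forall i u, P u -> P (x i * u)) ->
  forall u, P u.
Proof.
move=> P1 PD PZ PX u; have [w <-] := quot_pi_surj u.
elim/free_ind: w => [|v w IHv IHw|c v IH|i v IH].
- by rewrite rmorph1.
- by rewrite raddfD; apply: PD.
- by rewrite quot_piZ; apply: PZ.
- by rewrite rmorphM; apply: PX.
Qed.

Lemma bq_relation (k : 'I_3) :
  x (bq_pair k).2 * x (bq_pair k).1 =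
    Q 0 k *: (x (bq_pair k).1 * x (bq_pair k).2)
    + (\sum_l AA k l *: x l + BB 0 k *: (1 : A)).
Proof.
set r := fun r => exists k, r = bq_relator Q AA BB k.
have /quot_piP : in_ideal r (bq_relator Q AA BB k - 0).
  by rewrite subr0; apply: in_ideal_gen; exists k.
rewrite /bq_relator; case: (bq_pair k) => i j /=.
rewrite raddf0 !raddfB /= quot_piZ !rmorphM -addrA -opprD => /subr0_eq.
rewrite /bq_gen => ->; rewrite raddfD raddf_sum /= quot_piZ rmorph1.
by congr (_ + (_ + _)); apply: eq_bigr => l _; rewrite quot_piZ.
Qed.

Section Action.
Variables (V : lmodType K) (X : 'I_3 -> V -> V).
Hypothesis X_linear : forall i, linear (X i).
Hypothesis X_rel : forall k v,
  X (bq_pair k).2 (X (bq_pair k).1 v) =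
    Q 0 k *: X (bq_pair k).1 (X (bq_pair k).2 v)
    + (\sum_l AA k l *: X l v + BB 0 k *: v).

(** The chosen representative does not matter: see [bq_act_pi]. *)
Definition bq_act (w : A) (v : V) : V := free_act X (quot_rep w) v.

(** By [X_rel] the relators act as zero, and the elements acting as zero form a two-sided ideal
    because the action is multiplicative and linear. *)
Lemma free_act_ideal u v :
  in_ideal (fun r => exists k, r = bq_relator Q AA BB k) u ->
  free_act X u v = 0.
Proof.
have act0 w : free_act X 0 w = 0.
  by rewrite -(scale0r (1 : free_alg K 3)) free_actZl scale0r.
have actN u' w : free_act X (- u') w = - free_act X u' w.
  by rewrite -(scaleN1r u') free_actZl scaleN1r.
move=> Iu; elim: Iu v => {u} [u [k ->]||u w _ IHu _ IHw|a u b _ IH] v.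
- rewrite /bq_relator; have := X_rel k v; case: (bq_pair k) => i j /= rel.
  rewrite !free_actDl !actN free_actZl !free_actM // !free_act_gen rel.
  rewrite free_actDl free_actZl free_act1 [X in X + _]addrAC subrr add0r.
  rewrite (big_morph (free_act X ^~ v)
             (fun u w => free_actDl _ u w v) (act0 v)).
  apply/eqP; rewrite subr_eq0; apply/eqP; congr (_ + _); apply: eq_bigr => l _.
  by rewrite free_actZl free_act_gen.
- exact: act0.
- by rewrite free_actDl actN IHu IHw subr0.
- rewrite !free_actM // IH.
  (* Linearity at scalar -1 and zero vectors gives that [a] sends 0 to 0. *)
  by have := free_act_linearr X_linear a (-1) 0 0; rewrite !scaleN1r !addNr.
Qed.

Lemma bq_act_pi u v : bq_act (quot_pi _ u) v = free_act X u v.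
Proof.
rewrite /bq_act; set w := quot_rep _.
have /(free_act_ideal v) : in_ideal
    (fun r => exists k, r = bq_relator Q AA BB k) (w - u).
  by apply/quot_piP; rewrite quot_repK.
by rewrite free_actDl -scaleN1r free_actZl scaleN1r => /subr0_eq.
Qed.

Lemma bq_act_linearl v : linear (bq_act^~ v).
Proof.
move=> c u w; have [u' <-] := quot_pi_surj u; have [w' <-] := quot_pi_surj w.
by rewrite -quot_piZ -raddfD !bq_act_pi free_act_linearl.
Qed.

Lemma bq_act1 v : bq_act 1 v = v.
Proof. by rewrite [LHS]bq_act_pi free_act1. Qed.

Lemma bq_act_gen i v : bq_act (x i) v = X i v.
Proof. by rewrite bq_act_pi free_act_gen. Qed.

Lemma bq_actM u w v : bq_act (u * w) v = bq_act u (bq_act w v).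
Proof.
have [u' <-] := quot_pi_surj u; have [w' <-] := quot_pi_surj w.
by rewrite -rmorphM !bq_act_pi free_actM.
Qed.

End Action.

End BqPresentation.

(** * Universal property of the presentation: existence and uniqueness of morphisms *)

Section BqMorphism.
Variables (K : fieldType) (Q Q' : 'rV[K]_3) (AA AA' : 'M[K]_3).
Variables (BB BB' : 'rV[K]_3).
Local Notation A := (bq_alg Q AA BB).
Local Notation A' := (bq_alg Q' AA' BB').

(** Left multiplications by the [y i] satisfy the relations of [A], so they make [A'] an [A]-module;
    the morphism is the orbit map of 1. *)
Lemma bq_lift (y : 'I_3 -> A') :
    (forall k, y (bq_pair k).2 * y (bq_pair k).1 =
       Q 0 k *: (y (bq_pair k).1 * y (bq_pair k).2)
       + (\sum_l AA k l *: y l + BB 0 k *: (1 : A'))) ->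
  exists phi : A -> A', [/\ linear phi, monoid_morphism phi &
    forall i, phi (bq_gen Q AA BB i) = y i].
Proof.
move=> y_rel; pose X i (v : A') : A' := y i * v.
have X_linear i : linear (X i).
  by move=> c u v; rewrite /X mulrDr bq_algAr.
have X_rel k v : X (bq_pair k).2 (X (bq_pair k).1 v) =
    Q 0 k *: X (bq_pair k).1 (X (bq_pair k).2 v)
    + (\sum_l AA k l *: X l v + BB 0 k *: v).
  rewrite /X mulrA y_rel !mulrDl -!bq_algAl mul1r -mulrA mulr_suml.
  by congr (_ + (_ + _)); apply: eq_bigr => l _; rewrite bq_algAl.
(* Each element acts as left multiplication by its value at 1; this makes the orbit map
   multiplicative. *)
have actE (u : A) : forall v, bq_act X u v = bq_act X u 1 * v.
  elim/bq_ind: u => [|u w IHu IHw|c u IH|i u IH] v.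
  - by rewrite !bq_act1 // mul1r.
  - have actD z := bq_act_linearl X_linear X_rel z 1 u w.
    move: (actD v) (actD 1); rewrite !scale1r => -> ->.
    by rewrite mulrDl IHu IHw.
  - have actZ z := bq_act_linearl X_linear X_rel z c u 0.
    have act0 z : bq_act X (0 : A) z = 0.
      have := bq_act_linearl X_linear X_rel z (-1) 0 0.
      by rewrite !scaleN1r !addNr.
    move: (actZ v) (actZ 1); rewrite !act0 !addr0 => -> ->.
    by rewrite -bq_algAl IH.
  - by rewrite !bq_actM // IH !bq_act_gen // /X mulrA.
exists (fun u => bq_act X u 1); split.
- exact: bq_act_linearl.
- by split; [rewrite bq_act1 | move=> u v; rewrite bq_actM // actE].
- by move=> i; rewrite bq_act_gen // /X mulr1.
Qed.

End BqMorphism.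

Lemma bq_endo_id (K : fieldType) (Q : 'rV[K]_3) (AA : 'M[K]_3) (BB : 'rV[K]_3)
    (phi : bq_alg Q AA BB -> bq_alg Q AA BB) :
    linear phi -> monoid_morphism phi ->
    (forall i, phi (bq_gen Q AA BB i) = bq_gen Q AA BB i) ->
  phi =1 id.
Proof.
move=> phiL [phi1 phiM] phiX; elim/bq_ind => [|u v IHu IHv|c u IH|i u IH] //.
- by have := phiL 1 u v; rewrite !scale1r IHu IHv.
- have phi0 : phi 0 = 0.
    by have := phiL (-1) 0 0; rewrite !scaleN1r !addNr.
  by have := phiL c u 0; rewrite phi0 !addr0 IH.
- by rewrite phiM phiX IH.
Qed.

Lemma ord3P (P : 'I_3 -> Prop) : P 0 -> P 1 -> P 2 -> forall k, P k.
Proof.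
move=> P0 P1 P2 [[|[|[|//]]] lt_k].
- by rewrite (_ : Ordinal _ = 0) //; apply: val_inj.
- by rewrite (_ : Ordinal _ = 1) //; apply: val_inj.
- by rewrite (_ : Ordinal _ = 2) //; apply: val_inj.
Qed.

(** * The PBW basis of the quantum space *)

Section Span.
Variables (K : fieldType) (V : lmodType K) (I : eqType) (b : I -> V).

(** Inductive constructions give lists of pairs with possibly repeated indices, while [is_basis]
    wants coefficients as a function of the index; repetitions are summed. *)
Lemma span_uniq (l : seq (I * K)) :
  exists (s : seq I) (c : I -> K),
    \sum_(p <- l) p.2 *: b p.1 = \sum_(i <- s) c i *: b i.
Proof.
exists (undup (map fst l)), (fun i => \sum_(p <- l | p.1 == i) p.2).
under [RHS]eq_bigr => i _ do rewrite scaler_suml big_mkcond.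
rewrite exchange_big /= big_seq [RHS]big_seq; apply: eq_bigr => p lp.
rewrite -big_mkcond (big_rem p.1) /= ?mem_undup ?map_f // eqxx.
rewrite big1_seq ?addr0 //.
move=> i /andP[/eqP <-]; rewrite mem_rem_uniq ?undup_uniq //.
by rewrite inE /= eqxx.
Qed.

End Span.

Section QuantumSpace.
Variables (K : fieldType) (Q : 'rV[K]_3).
Local Notation S := (bq_alg Q 0 0).
Local Notation x := (bq_gen Q 0 0).
Local Notation mono := (bq_monomial Q 0 0).

Lemma qs_rel k :
  x (bq_pair k).2 * x (bq_pair k).1 =
    Q 0 k *: (x (bq_pair k).1 * x (bq_pair k).2).
Proof.
rewrite bq_relation mxE scale0r addr0 big1 ?addr0 // => l _.
by rewrite mxE scale0r.
Qed.

Lemma qs_gen0_mono a b c : x 0 * mono (a, b, c) = mono (a.+1, b, c).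
Proof. by rewrite /bq_monomial /= exprS !mulrA. Qed.

Lemma qs_gen1_mono a b c :
  x 1 * mono (a, b, c) = Q 0 0 ^+ a *: mono (a, b.+1, c).
Proof.
rewrite /bq_monomial /= !mulrA (bq_qcommX _ (qs_rel 0)) exprS.
by rewrite -!bq_algAl !mulrA.
Qed.

(** Moving x_3 to the right past x_1^a and then x_2^b costs q_2^a and q_3^b. *)
Lemma qs_gen2_mono a b c :
  x 2 * mono (a, b, c) = (Q 0 1 ^+ a * Q 0 2 ^+ b) *: mono (a, b, c.+1).
Proof.
have r20 := bq_qcommX a (qs_rel 1); have r21 := bq_qcommX b (qs_rel 2).
rewrite /= in r20 r21.
rewrite /bq_monomial /= !mulrA r20 exprS -!bq_algAl -(mulrA _ (x 2)) r21.
by rewrite -bq_algAr -!bq_algAl scalerA !mulrA.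
Qed.

(** The span of the ordered monomials contains 1 and is stable under left multiplication by each
    generator. *)
Lemma qs_span (u : S) : exists l : seq ((nat * nat * nat) * K),
  u = \sum_(p <- l) p.2 *: mono p.1.
Proof.
elim/bq_ind: u => [|u v [l ->] [l' ->]|c u [l ->]|i u [l ->]].
- exists [:: ((0, 0, 0)%N, 1)].
  by rewrite big_seq1 scale1r /bq_monomial /= !expr0 !mulr1.
- by exists (l ++ l'); rewrite big_cat.
- exists [seq (p.1, c * p.2) | p <- l]; rewrite big_map scaler_sumr.
  by apply: eq_bigr => p _; rewrite scalerA.
(* [up j e] is the exponent and the scalar of the generator j times the monomial e; the default of
   [nth] is never reached. *)
- pose up (j : 'I_3) (e : nat * nat * nat) := let: (a, b, c) := e in
    nth ((0, 0, 0)%N, 0) [:: ((a.+1, b, c), 1); ((a, b.+1, c), Q 0 0 ^+ a);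
      ((a, b, c.+1), Q 0 1 ^+ a * Q 0 2 ^+ b)] j : (nat * nat * nat) * K.
  exists [seq ((up i p.1).1, p.2 * (up i p.1).2) | p <- l].
  rewrite big_map mulr_sumr; apply: eq_bigr => -[[[a b] c] d] _.
  rewrite -bq_algAr -scalerA; congr (_ *: _).
  elim/ord3P: i => /=.
  + by rewrite qs_gen0_mono scale1r.
  + by rewrite qs_gen1_mono.
  + by rewrite qs_gen2_mono.
Qed.

Local Notation V := (nat * nat * nat -> K^o).

(* The action of the generators on the quantum space, transported to the
   coordinate functions in the basis of ordered monomials. *)
Definition qs_op (i : 'I_3) (f : V) : V := fun e =>
  let: (a, b, c) := e in
  nth 0 [:: if a is a'.+1 then f (a', b, c) else 0;
            if b is b'.+1 then Q 0 0 ^+ a * f (a, b', c) else 0;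
            if c is c'.+1 then Q 0 1 ^+ a * Q 0 2 ^+ b * f (a, b, c') else 0] i.

Lemma qs_op_linear i : linear (qs_op i).
Proof.
move=> c f g; apply/funext => -[[a b] d]; rewrite !fctE /=.
elim/ord3P: i => /=.
- by case: a => [|a]; rewrite ?scaler0 ?addr0.
- by case: b => [|b]; rewrite ?scaler0 ?addr0 // /GRing.scale /=; ring.
- by case: d => [|d]; rewrite ?scaler0 ?addr0 // /GRing.scale /=; ring.
Qed.

(** Both composites shift the same two exponents; in one of them the scalar is read after the first
    exponent has been raised, hence the extra factor q_k. *)
Lemma qs_op_rel k v :
  qs_op (bq_pair k).2 (qs_op (bq_pair k).1 v) =
    Q 0 k *: qs_op (bq_pair k).1 (qs_op (bq_pair k).2 v)
    + (\sum_l (0 : 'M_3) k l *: qs_op l v + (0 : 'rV_3) 0 k *: v).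
Proof.
rewrite mxE scale0r addr0 big1 => [|l _]; last by rewrite mxE scale0r.
rewrite addr0; apply/funext => -[[a b] c]; rewrite !fctE /GRing.scale /=.
elim/ord3P: k => /=.
- by case: a b => [|a] [|b] //=; rewrite ?mulr0 // exprS; ring.
- by case: a c => [|a] [|c] //=; rewrite ?mulr0 // exprS; ring.
- by case: b c => [|b] [|c] //=; rewrite ?mulr0 // exprS; ring.
Qed.

Local Notation act := (@bq_act K Q 0 0 V qs_op).
Let delta (e : nat * nat * nat) : V := fun e' => (e' == e)%:R.

(** The powers act in the order x_3, x_2, x_1, so each operator meets zero exponents in the earlier
    variables and all scalars are 1. *)
Lemma qs_act_mono e : act (mono e) (delta (0, 0, 0)%N) = delta e.
Proof.
have L := qs_op_linear; have R := qs_op_rel.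
have actX i n f : act (x i ^+ n) f = iter n (qs_op i) f.
  elim: n => [|n IH]; first by rewrite expr0 bq_act1.
  by rewrite exprS bq_actM // bq_act_gen //= IH.
case: e => [[a b] c]; rewrite /bq_monomial /= !bq_actM // !actX.
have -> : iter c (qs_op 2) (delta (0, 0, 0)%N) = delta (0, 0, c)%N.
  elim: c => //= c ->; apply/funext => -[[a' b'] [|c']] /=.
    by rewrite /delta !xpair_eqE andbF.
  rewrite /delta !xpair_eqE eqSS.
  by case: a' => [|a']; case: b' => [|b']; rewrite /= ?mulr0 ?mul1r.
have -> : iter b (qs_op 1) (delta (0, 0, c)%N) = delta (0, b, c)%N.
  elim: b => //= b ->; apply/funext => -[[a' [|b']] c'] /=.
    by rewrite /delta !xpair_eqE andbF.
  rewrite /delta !xpair_eqE eqSS.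
  by case: a' => [|a']; rewrite /= ?mulr0 ?mul1r.
elim: a => //= a ->; apply/funext => -[[[|a'] b'] c'] /=.
  by rewrite /delta !xpair_eqE.
by rewrite /delta !xpair_eqE eqSS.
Qed.

Lemma quantum_space_basis : is_basis mono.
Proof.
split=> [u|s c uniq_s s0 e se].
  by have [l ->] := qs_span u; apply: span_uniq.
have L := qs_op_linear; have R := qs_op_rel.
have act0 : act 0 (delta (0, 0, 0)%N) = 0.
  have := bq_act_linearl L R (delta (0, 0, 0)%N) (-1) 0 0.
  by rewrite !scaleN1r !addNr.
have actS : act (\sum_(i <- s) c i *: mono i) (delta (0, 0, 0)%N)
    = \sum_(i <- s) c i *: delta i.
  elim: (s) => [|i r IH]; first by rewrite !big_nil.
  by rewrite !big_cons -IH -(qs_act_mono i) bq_act_linearl.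
(* The vanishing combination, applied to the delta at the origin and evaluated at e, leaves only the
   coefficient [c e]. *)
move: actS; rewrite s0 act0 fct_sumE => /(congr1 (@^~ e)) /esym.
rewrite (big_rem e) //= big1_seq ?addr0 /=.
  by rewrite fctE /delta eqxx /GRing.scale /= mulr1.
move=> i; rewrite mem_rem_uniq // inE fctE /delta eq_sym => /andP[/negbTE -> _].
by rewrite scaler0.
Qed.

End QuantumSpace.

(** * The overlap x_3 x_2 x_1 and its coefficient equations *)

Lemma eq_subr (R : zmodType) (u v w z : R) : u = v -> w - z = u - v -> w = z.
Proof. by move=> ->; rewrite subrr => /subr0_eq. Qed.

Section Overlap.
Variables (K : fieldType) (Q : 'rV[K]_3) (AA : 'M[K]_3) (BB : 'rV[K]_3).
Local Notation A := (bq_alg Q AA BB).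
Local Notation x := (bq_gen Q AA BB).
Local Notation mono := (bq_monomial Q AA BB).

(** All exponents of degree at most two and that of x_1 x_2 x_3: both reductions of x_3 x_2 x_1 lie
    in the span of these monomials. *)
Let expo : seq (nat * nat * nat) :=
  [:: (0, 0, 0); (1, 0, 0); (0, 1, 0); (0, 0, 1); (2, 0, 0); (0, 2, 0);
      (0, 0, 2); (1, 1, 0); (1, 0, 1); (0, 1, 1); (1, 1, 1)]%N.

Let comb (f : nat * nat * nat -> K) : A := \sum_(e <- expo) f e *: mono e.

Let combD f g : comb f + comb g = comb (fun e => f e + g e).
Proof. by rewrite -big_split; apply: eq_bigr => e _; rewrite scalerDl. Qed.

Let combZ c f : c *: comb f = comb (fun e => c * f e).
Proof. by rewrite scaler_sumr; apply: eq_bigr => e _; rewrite scalerA. Qed.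

Let comb1 e : e \in expo -> mono e = comb (fun e' => (e' == e)%:R).
Proof.
move=> es; rewrite /comb (big_rem e) // eqxx scale1r -[LHS]addr0.
congr (_ + _); rewrite big1_seq // => i /andP[_].
by rewrite mem_rem_uniq // inE => /andP[/negbTE -> _]; rewrite scale0r.
Qed.

Let comb_inj f g : is_basis mono -> comb f = comb g -> {in expo, f =1 g}.
Proof.
move=> [_ indep] fg e es; apply/eqP; rewrite -subr_eq0; apply/eqP.
apply: (indep expo (fun e => f e - g e)) => //.
rewrite -[RHS](subrr (comb g)) -[X in X - _]fg /comb -sumrB.
by apply: eq_bigr => i _; rewrite scalerBl.
Qed.

(** The three groups are the coefficients of the squares, of the mixed quadratic monomials and of
    the generators, each group in lexicographic order of the monomials. *)
Lemma bq_overlap : is_basis mono ->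
  [/\ (1 - Q 0 0 * Q 0 1) * AA 2 0 = 0,
      (Q 0 0 - Q 0 2) * AA 1 1 = 0 & (1 - Q 0 1 * Q 0 2) * AA 0 2 = 0] /\
  [/\ Q 0 0 * ((1 - Q 0 1) * AA 2 1) = Q 0 0 * ((1 - Q 0 2) * AA 1 0),
      Q 0 1 * ((1 - Q 0 0) * AA 2 2) = Q 0 1 * ((1 - Q 0 2) * AA 0 0) &
      Q 0 2 * ((1 - Q 0 0) * AA 1 2) = Q 0 2 * ((1 - Q 0 1) * AA 0 1)] /\
  [/\ (1 - Q 0 0 * Q 0 1) * BB 0 2 =
        AA 0 0 * AA 1 0 * (1 - Q 0 2) - AA 2 1 * AA 0 0 - AA 2 2 * AA 1 0
        + AA 2 0 * (Q 0 0 * AA 1 2 + AA 0 1),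
      (Q 0 0 - Q 0 2) * BB 0 1 =
        Q 0 2 * AA 1 0 * AA 0 1 - Q 0 0 * AA 1 2 * AA 2 1
        + AA 1 1 * (AA 2 2 - AA 0 0) &
      (1 - Q 0 1 * Q 0 2) * BB 0 0 =
        AA 2 2 * AA 1 2 * (1 - Q 0 0) - AA 0 0 * AA 1 2 - AA 0 1 * AA 2 2
        + AA 0 2 * (Q 0 2 * AA 1 0 + AA 2 1)].
Proof.
move=> basis.
have R k := bq_relation Q AA BB k.
have := R 0; have := R 1; have := R 2.
rewrite /= !big_ord_recr !big_ord0 /= !add0r.
rewrite (_ : widen_ord _ _ = 0 :> 'I_3); last exact: val_inj.
rewrite (_ : widen_ord _ _ = 1 :> 'I_3); last exact: val_inj.
rewrite (_ : ord_max = 2 :> 'I_3); last exact: val_inj.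
move=> R21 R20 R10.
have c1 : x 0 = comb (fun e => (e == (1, 0, 0)%N)%:R).
  by rewrite -comb1 // /bq_monomial !expr0 !mulr1.
have c2 : x 1 = comb (fun e => (e == (0, 1, 0)%N)%:R).
  by rewrite -comb1 // /bq_monomial !expr0 mulr1 mul1r.
have c3 : x 2 = comb (fun e => (e == (0, 0, 1)%N)%:R).
  by rewrite -comb1 // /bq_monomial !expr0 !mul1r.
have c0 : (1 : A) = comb (fun e => (e == (0, 0, 0)%N)%:R).
  by rewrite -comb1 // /bq_monomial !expr0 !mulr1.
have c11 : x 0 * x 0 = comb (fun e => (e == (2, 0, 0)%N)%:R).
  by rewrite -comb1 // /bq_monomial !expr0 !mulr1.
have c22 : x 1 * x 1 = comb (fun e => (e == (0, 2, 0)%N)%:R).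
  by rewrite -comb1 // /bq_monomial !expr0 mulr1 mul1r.
have c33 : x 2 * x 2 = comb (fun e => (e == (0, 0, 2)%N)%:R).
  by rewrite -comb1 // /bq_monomial !expr0 !mul1r.
have c12 : x 0 * x 1 = comb (fun e => (e == (1, 1, 0)%N)%:R).
  by rewrite -comb1 // /bq_monomial !expr0 mulr1.
have c13 : x 0 * x 2 = comb (fun e => (e == (1, 0, 1)%N)%:R).
  by rewrite -comb1 // /bq_monomial !expr0 mulr1.
have c23 : x 1 * x 2 = comb (fun e => (e == (0, 1, 1)%N)%:R).
  by rewrite -comb1 // /bq_monomial !expr0 mul1r.
have c123 : x 0 * (x 1 * x 2) = comb (fun e => (e == (1, 1, 1)%N)%:R).
  by rewrite -comb1 // /bq_monomial mulrA.
move: c0 c1 c2 c3 c11 c22 c33 c12 c13 c23 c123 R10 R20 R21.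
(* With abstract generators, failed rewrites do not unfold the quotient. *)
move: (combD) (combZ) (fun f g => @comb_inj f g basis).
move: (comb) (x 0) (x 1) (x 2) => cb x0 x1 x2 cbD cbZ cb_inj.
move=> c0 c1 c2 c3 c11 c22 c33 c12 c13 c23 c123 R10 R20 R21.
have Mr (y u u0 u1 u2 : A) d d0 d1 d2 d3 :
    y * (d *: u + (d0 *: u0 + d1 *: u1 + d2 *: u2 + d3 *: (1 : A))) =
    d *: (y * u) + (d0 *: (y * u0) + d1 *: (y * u1) + d2 *: (y * u2) + d3 *: y).
  by rewrite !mulrDr -!bq_algAr mulr1.
have Ml (y u u0 u1 u2 : A) d d0 d1 d2 d3 :
    (d *: u + (d0 *: u0 + d1 *: u1 + d2 *: u2 + d3 *: (1 : A))) * y =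
    d *: (u * y) + (d0 *: (u0 * y) + d1 *: (u1 * y) + d2 *: (u2 * y) + d3 *: y).
  by rewrite !mulrDl -!bq_algAl mul1r.
have e1 : x2 * (x1 * x0) = (x2 * x1) * x0 by rewrite mulrA.
(* Cubic terms still to be ordered: [e2] then [e3] finish the reduction of x_3 (x_2 x_1), [e4] then
   [e5] that of (x_3 x_2) x_1. *)
have e2 : x2 * x0 * x1 = _ := congr1 (fun u => u * x1) R20.
have e3 : x0 * (x2 * x1) = _ := congr1 (fun u => x0 * u) R21.
have e4 : x1 * (x2 * x0) = _ := congr1 (fun u => x1 * u) R20.
have e5 : x1 * x0 * x2 = _ := congr1 (fun u => u * x2) R10.
rewrite /= Ml in e2; rewrite /= Mr in e3; rewrite /= Mr in e4.
rewrite /= Ml in e5.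
rewrite -(mulrA x0 x2) e3 in e2; rewrite (mulrA x1 x0) e5 in e4.
rewrite R10 Mr R21 Ml mulrA e2 -(mulrA x1) e4 R20 R10 R21 in e1.
rewrite -(mulrA x0) in e1.
move: e1; rewrite c123 c11 c22 c33 c12 c13 c23 c1 c2 c3 c0.
rewrite !(cbD, cbZ) => /cb_inj E.
(* Each goal follows from the equality of the coefficients at e once the two differences agree, an
   identity left to [ring]; [esym] adjusts the sign. *)
have coef e (P P' : K) : e \in expo -> _ -> P = P' :=
  fun es => eq_subr (E e es).
split; [split|split; split].
- by apply/esym/(coef (2, 0, 0)%N) => //=; ring.
- by apply: (coef (0, 2, 0)%N) => //=; ring.
- by apply: (coef (0, 0, 2)%N) => //=; ring.
- by apply/esym/(coef (1, 1, 0)%N) => //=; ring.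
- by apply/esym/(coef (1, 0, 1)%N) => //=; ring.
- by apply/esym/(coef (0, 1, 1)%N) => //=; ring.
- by apply/esym/(coef (1, 0, 0)%N) => //=; ring.
- by apply: (coef (0, 1, 0)%N) => //=; ring.
- by apply: (coef (0, 0, 1)%N) => //=; ring.
Qed.

End Overlap.

(** * Recognizing the structure constants as those of a translated quantum space *)

(* The data of K[x; Q, 0, 0] with respect to the generators x_i + m_i. *)
Definition translation_data (K : fieldType) (Q : 'rV[K]_3) (AA : 'M[K]_3)
    (BB m : 'rV[K]_3) := forall k, let: (i, j) := bq_pair k in
  (forall l, AA k l = (1 - Q 0 k) * (m 0 i *+ (l == j) + m 0 j *+ (l == i))) /\
  BB 0 k = - ((1 - Q 0 k) * (m 0 i * m 0 j)).

(** The three nonvanishing factors are cancelled twice: in the equations of the squares, to kill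
    three entries of [AA], and in those of degree one, to find [BB]. *)
Lemma bq_translation_data (K : fieldType) (Q : 'rV[K]_3) (AA : 'M[K]_3)
    (BB : 'rV[K]_3) :
    bi_quadratic Q AA BB -> (forall i, Q 0 i != 1) -> Q 0 0 - Q 0 2 != 0 ->
    1 - Q 0 0 * Q 0 1 != 0 -> 1 - Q 0 1 * Q 0 2 != 0 ->
  exists m, translation_data Q AA BB m.
Proof.
move=> [q0 basis] q1 q02 q01 q12.
have q1' k : 1 - Q 0 k != 0 by rewrite subr_eq0 eq_sym.
have [[A20 A11 A02] [[A21 A22 A12] [B2 B1 B0]]] := bq_overlap basis.
have {}A20 : AA 2 0 = 0 by apply: (mulfI q01); rewrite A20 mulr0.
have {}A11 : AA 1 1 = 0 by apply: (mulfI q02); rewrite A11 mulr0.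
have {}A02 : AA 0 2 = 0 by apply: (mulfI q12); rewrite A02 mulr0.
(* The shifts are read off the first two rows: x_1 x_2 gives m_1 and m_2, and x_1 x_3 gives m_3. *)
pose m0 := AA 0 1 / (1 - Q 0 0); pose m1 := AA 0 0 / (1 - Q 0 0).
pose m2 := AA 1 0 / (1 - Q 0 1).
have A01 : AA 0 1 = (1 - Q 0 0) * m0 by rewrite mulrC divfK.
have A00 : AA 0 0 = (1 - Q 0 0) * m1 by rewrite mulrC divfK.
have A10 : AA 1 0 = (1 - Q 0 1) * m2 by rewrite mulrC divfK.
(* The mixed quadratic equations show that the remaining entries yield the same shifts, after
   cancelling some q_i and some 1 - q_j. *)
have {}A21 : AA 2 1 = (1 - Q 0 2) * m2.
  by apply: (mulfI (q1' 1)); rewrite (mulfI (q0 0) A21) A10 mulrCA.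
have {}A22 : AA 2 2 = (1 - Q 0 2) * m1.
  by apply: (mulfI (q1' 0)); rewrite (mulfI (q0 1) A22) A00 mulrCA.
have {}A12 : AA 1 2 = (1 - Q 0 1) * m0.
  by apply: (mulfI (q1' 0)); rewrite (mulfI (q0 2) A12) A01 mulrCA.
rewrite A20 A11 A02 A21 A22 A12 A01 A00 A10 in B0 B1 B2.
exists (\row_i nth 0 [:: m0; m1; m2] i); elim/ord3P; rewrite /= !mxE /=.
- split; last by apply: (mulfI q12); rewrite B0; ring.
  by elim/ord3P; rewrite ?A00 ?A01 ?A02 /= ?add0r ?addr0 ?mulr0.
- split; last by apply: (mulfI q02); rewrite B1; ring.
  by elim/ord3P; rewrite ?A10 ?A11 ?A12 /= ?add0r ?addr0 ?mulr0.
- split; last by apply: (mulfI q01); rewrite B2; ring.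
  by elim/ord3P; rewrite ?A20 ?A21 ?A22 /= ?add0r ?addr0 ?mulr0.
Qed.

(** The factor 1 - q_k is exposed to match the one produced by [translate_qcomm]. The family [z] is
    arbitrary because both the generators of the given algebra and the translated ones of the
    quantum space are substituted. *)
Lemma translation_sum (K : fieldType) (Q : 'rV[K]_3) (AA : 'M[K]_3)
    (BB m : 'rV[K]_3) (V : lmodType K) (z : 'I_3 -> V) (e : V) k :
    translation_data Q AA BB m ->
  \sum_l AA k l *: z l + BB 0 k *: e =
    (1 - Q 0 k) *: (m 0 (bq_pair k).1 *: z (bq_pair k).2
      + m 0 (bq_pair k).2 *: z (bq_pair k).1
      - (m 0 (bq_pair k).1 * m 0 (bq_pair k).2) *: e).
Proof.
have sum_delta a j : \sum_l (a *+ (l == j)) *: z l = a *: z j.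
  rewrite (bigD1 j) //= eqxx mulr1n big1 ?addr0 // => l /negbTE ->.
  by rewrite mulr0n scale0r.
move=> /(_ k); case: (bq_pair k) => i j [AAk ->] /=.
rewrite scalerBr scalerA -scaleNr -(sum_delta _ j) -(sum_delta _ i) -big_split.
rewrite scaler_sumr; congr (_ + _); apply: eq_bigr => l _.
by rewrite /= AAk -scalerDl scalerA.
Qed.

Section TranslateGenerators.
Variables (K : fieldType) (Q : 'rV[K]_3) (AA : 'M[K]_3) (BB : 'rV[K]_3).
Local Notation A := (bq_alg Q AA BB).
Local Notation e := (1 : A).

(** Both translated products differ from the original ones by the same t = a v + b u + ab, so the
    defect changes by t - q t. *)
Lemma translate_qcomm (u v w : A) (q a b : K) :
    v * u = q *: (u * v) + w ->
  (v + b *: e) * (u + a *: e) = q *: ((u + a *: e) * (v + b *: e))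
    + (w + (1 - q) *: (a *: v + b *: u + (a * b) *: e)).
Proof.
move=> vu; set t := a *: v + b *: u + _.
have -> : (v + b *: e) * (u + a *: e) = v * u + t.
  rewrite mulrDr !mulrDl -!bq_algAl -!bq_algAr mul1r !mulr1 scalerA.
  rewrite [b * a]mulrC.
  by rewrite /t -addrA; congr (_ + _); rewrite addrCA addrA.
have -> : (u + a *: e) * (v + b *: e) = u * v + t.
  rewrite mulrDr !mulrDl -!bq_algAl -!bq_algAr mul1r !mulr1 scalerA.
  by rewrite /t -!addrA.
clearbody t; rewrite vu scalerDr scalerBl scale1r -!addrA; congr (_ + _).
by rewrite [RHS]addrCA [q *: t + _]addrC subrK.
Qed.

End TranslateGenerators.

(** * The mutually inverse translations between the algebra and the quantum space *)

Theorem theorem1p11 (K : fieldType) (Q : 'rV[K]_3) (AA : 'M[K]_3)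
    (BB : 'rV[K]_3) :
  bi_quadratic Q AA BB ->
  (forall i, Q 0 i != 1) ->
  Q 0 0 - Q 0 2 != 0 ->
  1 - Q 0 0 * Q 0 1 != 0 ->
  1 - Q 0 1 * Q 0 2 != 0 ->
  [/\ bi_quadratic Q 0 0,
      G3_equiv Q AA BB 0 0 &
      exists psi : bq_alg Q AA BB -> quantum_space Q, alg_iso psi].
Proof.
move=> biA q1 q02 q01 q12.
have [m mP] := bq_translation_data biA q1 q02 q01 q12.
pose A := bq_alg Q AA BB; pose S := bq_alg Q 0 0.
pose x := bq_gen Q AA BB; pose z := bq_gen Q 0 0.
have [phi [phiL phiM phiX]] : exists phi : S -> A,
    [/\ linear phi, monoid_morphism phi &
        forall i, phi (z i) = x i + (- m 0 i) *: (1 : A)].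
  apply: bq_lift => k.
  (* Translation by -m adds (1 - q_k)(- m_i x_j - m_j x_i + m_i m_j), the opposite of the affine
     part of the relation. *)
  have := translate_qcomm (- m 0 (bq_pair k).1) (- m 0 (bq_pair k).2)
    (bq_relation Q AA BB k).
  rewrite (translation_sum _ _ k mP) -scalerDr => ->; congr (_ + _).
  rewrite mxE scale0r addr0 big1 => [|l _]; last by rewrite mxE scale0r.
  by rewrite !scaleNr mulrNN -opprD addrACA subrr addNr addr0 scaler0.
have [psi [psiL psiM psiX]] : exists psi : A -> S,
    [/\ linear psi, monoid_morphism psi &
        forall i, psi (x i) = z i + m 0 i *: (1 : S)].
  apply: bq_lift => k.
  have := qs_rel Q k; rewrite -[RHS]addr0 => /translate_qcomm ->.
  rewrite (translation_sum _ _ k mP) add0r; congr (_ + _ *: _).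
  (* Expanding m_i (z_j + m_j) + m_j (z_i + m_i) - m_i m_j leaves one copy of m_i m_j. *)
  rewrite !scalerDr !scalerA [m 0 (bq_pair k).2 * _]mulrC addrA addrK.
  by rewrite addrAC.
(* Both composites are algebra endomorphisms fixing the generators, hence identities. *)
have phi_psi : cancel psi phi.
  apply: (@bq_endo_id _ _ _ _ (phi \o psi)) => /=.
  - by move=> c u v; rewrite /= psiL phiL.
  - by split=> [|u v] /=; rewrite ?psiM.1 ?phiM.1 // psiM.2 phiM.2.
  - move=> i; rewrite /= psiX addrC phiL phiM.1 phiX.
    by rewrite scaleNr addrC subrK.
have psi_phi : cancel phi psi.
  apply: (@bq_endo_id _ _ _ _ (psi \o phi)) => /=.
  - by move=> c u v; rewrite /= phiL psiL.
  - by split=> [|u v] /=; rewrite ?phiM.1 ?psiM.1 // phiM.2 psiM.2.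
  - move=> i; rewrite /= phiX addrC psiL psiM.1 psiX.
    by rewrite scaleNr addrC addrK.
split.
- by split; [case: biA | apply: quantum_space_basis].
(* No rescaling occurs: the new generators are x_i - m_i. *)
- exists (const_mx 1), (- m), phi; split.
  + by move=> i; rewrite mxE oner_neq0.
  + by split=> //; exists psi.
  + by move=> i; rewrite phiX !mxE scale1r.
- by exists psi; split=> //; exists phi.
Qed.
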